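(* Let $T$ be a theory with JCP, $\mathfrak M$ a monster model of $T$, and $\mathcal E$ a set of type-definable equivalence relations. Then $T$ is simple if and only if $T^{\mathcal E}$ is simple.
   Context: Positive logic: formulas are built from atomic formulas with $\top,\bot,\wedge,\vee,\exists$; a theory is a consistent set of h-inductive sentences $\forall x(\phi\to\psi)$ with $\phi,\psi$ positive; p.c. models are models such that every homomorphism from them into a model of the theory reflects positive formulas; JCP means any two models map homomorphically into a common model. $\mathfrak M$ is a monster model of $T$: a very saturated, very homogeneous p.c. model. Let $\mathcal L$ be the signature of $T$. A type-definable equivalence relation is a set $E(x,y)$ of positive $\mathcal L$-formulas without parameters, $x,y$ small tuples of variables of matching sorts, defining an equivalence relation on $\mathfrak M$. $\mathcal L_{\mathcal E}$ extends $\mathcal L$ by a sort $S_E$ for each $E\in\mathcal E$ and, for each finite tuple of variables $x$ (real or new sorts) and each $\mathcal L$-formula $\phi(x_r)$, a relation symbol $R_\phi(x)$, where $x_r$ replaces each variable of sort $S_E$ by a tuple of real variables matching $E$. $\mathfrak M^{\mathcal E}$ expands $\mathfrak M$ by interpreting $S_E$ as the set of $E$-classes and $R_\phi(c)$ as: some tuple of representatives of $c$ satisfies $\phi$ in $\mathfrak M$. $T^{\mathcal E}$ is the set of h-inductive $\mathcal L_{\mathcal E}$-sentences true in $\mathfrak M^{\mathcal E}$, and properties of $T^{\mathcal E}$ are evaluated in $\mathfrak M^{\mathcal E}$ (its monster model). Simplicity of a theory $S$ with monster model $\mathfrak N$ means $\mathsf{NTP}$: there is no formula $\phi(x,y)$,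 no $k\ge2$, no tuples $(a_\eta)_{\eta\in\omega^{<\omega}}$ in $\mathfrak N$ and no formula $\psi(y_1,\dots,y_k)$ with $S\models\neg\exists y_1\dots y_k(\psi\wedge\exists x\bigwedge_{j\le k}\phi(x,y_j))$ such that for every $\sigma\in\omega^\omega$ the set $\{\phi(x,a_{\sigma|_n}):n<\omega\}$ is consistent and for every $\eta\in\omega^{<\omega}$ and $i_1<\dots<i_k<\omega$, $\mathfrak N\models\psi(a_{\eta^\frown i_1},\dots,a_{\eta^\frown i_k})$ (here $\sigma|_n$ is the restriction to $n$ and $\eta^\frown i$ appends $i$). *)

(* Defs.v *)
From Corelib Require RelationClasses.
From mathcomp Require Import all_boot.

Set Implicit Arguments.
Unset Strict Implicit.
Unset Printing Implicit Defensive.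

Record signature := Signature {
  sorts : Type;
  funs : Type;
  fun_arity : funs -> nat;
  fun_dom : forall f : funs, 'I_(fun_arity f) -> sorts;
  fun_cod : funs -> sorts;
  rels : Type;
  rel_arity : rels -> nat;
  rel_dom : forall r : rels, 'I_(rel_arity r) -> sorts
}.

(** A tuple of variables is given by an index type [V], finite or not, and the
    sort [s v] of each variable [v : V].  A formula in the variables [s] only
    mentions finitely many of them, even when [V] is infinite. *)

Definition cat_sort (S V W : Type) (s : V -> S) (s' : W -> S) (v : V + W) : S :=
  match v with inl i => s i | inr j => s' j end.

Definition ext_sort (S V : Type) (t : S) (s : V -> S) (v : option V) : S :=
  match v with Some i => s i | None => t end.

Inductive term (L : signature) (V : Type) (s : V -> sorts L) : sorts L -> Type :=
| Var (v : V) : term s (s v)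
| App (f : funs L) (args : forall i, term s (@fun_dom L f i)) :
    term s (fun_cod f).

(** Atomic formulas include the equalities.  [Ex t phi] binds the variable
    [None], of sort [t], in [phi]. *)
Inductive form (L : signature) (V : Type) (s : V -> sorts L) : Type :=
| Top
| Bot
| Eq (t : sorts L) (a b : term s t)
| Rel (r : rels L) (args : forall i, term s (@rel_dom L r i))
| And (phi psi : form s)
| Or (phi psi : form s)
| Ex (t : sorts L) (phi : form (ext_sort t s)).

(** The sentence [forall x (hs_hyp -> hs_concl)], where [x] is a finite tuple. *)
Record h_inductive (L : signature) := HInductive {
  hs_arity : nat;
  hs_sort : 'I_hs_arity -> sorts L;
  hs_hyp : form hs_sort;
  hs_concl : form hs_sort
}.

(** Sorts may be empty; nonemptiness can be imposed by the h-inductive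
    sentences [Top -> exists x, Top]. *)
Record structure (L : signature) := Structure {
  carrier :> sorts L -> Type;
  fun_interp : forall f : funs L,
    (forall i, carrier (@fun_dom L f i)) -> carrier (fun_cod f);
  rel_interp : forall r : rels L,
    (forall i, carrier (@rel_dom L r i)) -> Prop
}.

Definition tup (L : signature) (M : structure L) (V : Type) (s : V -> sorts L) :=
  forall v : V, M (s v).

Definition cat_tup (L : signature) (M : structure L) (V W : Type)
    (s : V -> sorts L) (s' : W -> sorts L) (a : tup M s) (b : tup M s') :
    tup M (cat_sort s s') :=
  fun v => match v with inl i => a i | inr j => b j end.

Definition ext_tup (L : signature) (M : structure L) (V : Type) (t : sorts L)
    (s : V -> sorts L) (c : M t) (a : tup M s) : tup M (ext_sort t s) :=
  fun v => match v with Some i => a i | None => c end.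

Fixpoint eval (L : signature) (M : structure L) (V : Type) (s : V -> sorts L)
    (a : tup M s) (t : sorts L) (u : term s t) : M t :=
  match u with
  | Var v => a v
  | App f args => fun_interp (fun i => eval a (args i))
  end.

Fixpoint sat (L : signature) (M : structure L) (V : Type) (s : V -> sorts L)
    (a : tup M s) (phi : form s) {struct phi} : Prop :=
  match phi with
  | Top => True
  | Bot => False
  | Eq _ u v => eval a u = eval a v
  | Rel _ args => rel_interp (fun i => eval a (args i))
  | And phi psi => sat a phi /\ sat a psi
  | Or phi psi => sat a phi \/ sat a psi
  | Ex t phi => exists c : M t, sat (ext_tup c a) phi
  end.

Definition holds (L : signature) (M : structure L) (chi : h_inductive L) : Prop :=
  forall a : tup M (@hs_sort L chi), sat a (hs_hyp chi) -> sat a (hs_concl chi).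

Record hom (L : signature) (M N : structure L) := Hom {
  hom_map :> forall t, M t -> N t;
  hom_fun : forall (f : funs L) (a : forall i, M (@fun_dom L f i)),
    hom_map (fun_interp a) = fun_interp (fun i => hom_map (a i));
  hom_rel : forall (r : rels L) (a : forall i, M (@rel_dom L r i)),
    rel_interp a -> rel_interp (fun i => hom_map (a i))
}.

Definition hom_tup (L : signature) (M N : structure L) (h : hom M N) (V : Type)
    (s : V -> sorts L) (a : tup M s) : tup N s :=
  fun v => h _ (a v).

Definition automorphism (L : signature) (M : structure L) (h : hom M M) : Prop :=
  exists g : hom M M, forall t (c : M t), g t (h t c) = c /\ h t (g t c) = c.

Definition model (L : signature) (T : h_inductive L -> Prop) (M : structure L) :
    Prop :=
  forall chi, T chi -> holds M chi.

Definition theory (L : signature) (T : h_inductive L -> Prop) : Prop :=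
  exists M : structure L, model T M.

Definition JCP (L : signature) (T : h_inductive L -> Prop) : Prop :=
  forall M1 M2 : structure L, model T M1 -> model T M2 ->
  exists N : structure L,
    model T N /\ inhabited (hom M1 N) /\ inhabited (hom M2 N).

Definition pc_model (L : signature) (T : h_inductive L -> Prop)
    (M : structure L) : Prop :=
  model T M /\
  forall (N : structure L) (h : hom M N), model T N ->
  forall (n : nat) (s : 'I_n -> sorts L) (phi : form s) (a : tup M s),
    sat (hom_tup h a) phi -> sat a phi.

(** [#|A| < #|K|] for arbitrary types. *)
Definition card_smaller (A K : Type) : Prop :=
  (exists f : A -> K, injective f) /\ ~ (exists g : K -> A, injective g).

(** Every finitely satisfiable set of formulas in fewer than [#|K|] variables
    [x], over fewer than [#|K|] parameters [b], is satisfiable. *)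
Definition saturated (L : signature) (K : Type) (M : structure L) : Prop :=
  forall (V W : Type) (x : V -> sorts L) (y : W -> sorts L),
  card_smaller V K -> card_smaller W K ->
  forall (b : tup M y) (Sigma : form (cat_sort x y) -> Prop),
  (forall (n : nat) (phi : 'I_n -> form (cat_sort x y)),
     (forall i, Sigma (phi i)) ->
     exists a : tup M x, forall i, sat (cat_tup a b) (phi i)) ->
  exists a : tup M x, forall phi, Sigma phi -> sat (cat_tup a b) phi.

(** Any two tuples of length less than [#|K|] with the same positive type are
    conjugate under an automorphism. *)
Definition homogeneous (L : signature) (K : Type) (M : structure L) : Prop :=
  forall (V : Type) (x : V -> sorts L), card_smaller V K ->
  forall a b : tup M x,
  (forall phi : form x, sat a phi <-> sat b phi) ->
  exists h : hom M M, automorphism h /\ forall v, h _ (a v) = b v.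

(** "Small" means of cardinality less than [#|K|]; the first condition is
    [|L| + aleph_0 < #|K|]. *)
Definition monster (L : signature) (T : h_inductive L -> Prop) (K : Type)
    (M : structure L) : Prop :=
  card_smaller (sorts L + funs L + rels L + nat) K /\
  pc_model T M /\ saturated K M /\ homogeneous K M.

(** [phi(x, y)], [k], [(a_eta)] and [psi(y_1, ..., y_k)] witness the tree
    property of [T] in [M].  A set of formulas over the monster model is
    consistent when it is realised there. *)
Definition tree_property (L : signature) (T : h_inductive L -> Prop)
    (M : structure L) : Prop :=
  exists (m n : nat) (x : 'I_m -> sorts L) (y : 'I_n -> sorts L)
    (phi : form (cat_sort x y)) (k : nat)
    (psi : form (fun p : 'I_k * 'I_n => y p.2))
    (a : seq nat -> tup M y),
  2 <= k /\
  (forall N : structure L, model T N ->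
     ~ exists b : 'I_k -> tup N y,
         sat (M := N) (s := fun p : 'I_k * 'I_n => y p.2)
           (fun p => b p.1 p.2) psi /\
         exists c : tup N x, forall j, sat (cat_tup c (b j)) phi) /\
  (forall sigma : nat -> nat,
     exists c : tup M x,
       forall l : nat, sat (cat_tup c (a (mkseq sigma l))) phi) /\
  (forall (eta : seq nat) (i : 'I_k -> nat),
     (forall p q : 'I_k, p < q -> i p < i q) ->
     sat (M := M) (s := fun p : 'I_k * 'I_n => y p.2)
       (fun p => a (rcons eta (i p.1)) p.2) psi).

Definition simple (L : signature) (T : h_inductive L -> Prop)
    (M : structure L) : Prop :=
  ~ tree_property T M.

Definition defined_rel (L : signature) (M : structure L) (V : Type)
    (s : V -> sorts L) (E : form (cat_sort s s) -> Prop) (a b : tup M s) : Prop :=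
  forall phi, E phi -> sat (cat_tup a b) phi.

Record type_def_equiv (L : signature) (K : Type) (M : structure L) :=
  TypeDefEquiv {
    tde_index : Type;
    tde_small : card_smaller tde_index K;
    tde_sort : tde_index -> sorts L;
    tde_forms : form (cat_sort tde_sort tde_sort) -> Prop;
    tde_equiv : RelationClasses.Equivalence (defined_rel (M := M) tde_forms)
  }.

Section Hyperimaginaries.

Variables (L : signature) (K : Type) (M : structure L) (I : Type)
  (E : I -> type_def_equiv K M).

(** [inl t] is the real sort [t], and [inr i] is the sort of [E i]-classes. *)
Definition heq_sorts : Type := (sorts L + I)%type.

(** The tuple of real variables replacing a variable of sort [u]. *)
Definition real_index (u : heq_sorts) : Type :=
  match u with inl _ => unit | inr i => tde_index (E i) end.

Definition real_sort (u : heq_sorts) : real_index u -> sorts L :=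
  match u with inl t => fun _ => t | inr i => @tde_sort L K M (E i) end.

(** The tuple [x_r]: the variable [existT _ i j] is the [j]-th of those which
    replace [x i]. *)
Definition real_tuple_sort (n : nat) (x : 'I_n -> heq_sorts)
    (v : {i : 'I_n & real_index (x i)}) : sorts L :=
  real_sort (projT2 v).

Record R_symbol := RSymbol {
  R_arity : nat;
  R_sort : 'I_R_arity -> heq_sorts;
  R_form : form (real_tuple_sort (x := R_sort))
}.

Definition heq_sig : signature := {|
  sorts := heq_sorts;
  funs := funs L;
  fun_arity := @fun_arity L;
  fun_dom := fun f i => inl (@fun_dom L f i);
  fun_cod := fun f => inl (fun_cod f);
  rels := (rels L + R_symbol)%type;
  rel_arity := fun r =>
    match r with inl r0 => rel_arity r0 | inr R => R_arity R end;
  rel_dom := fun r =>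
    match r return
      'I_(match r with inl r0 => rel_arity r0 | inr R => R_arity R end) ->
      heq_sorts
    with
    | inl r0 => fun i => inl (@rel_dom L r0 i)
    | inr R => @R_sort R
    end
|}.

Definition heq_carrier (u : heq_sorts) : Type :=
  match u with
  | inl t => M t
  | inr i => {C : tup M (@tde_sort L K M (E i)) -> Prop |
               exists a, C = defined_rel (@tde_forms L K M (E i)) a}
  end.

(** [a] is a tuple of representatives of [c]. *)
Definition represents (u : heq_sorts) :
    (forall j : real_index u, M (real_sort j)) -> heq_carrier u -> Prop :=
  match u with
  | inl t => fun a c => a tt = c
  | inr i => fun a c => sval c a
  end.

Definition R_interp (R : R_symbol) (c : forall i, heq_carrier (@R_sort R i)) :
    Prop :=
  exists a : tup M (real_tuple_sort (x := @R_sort R)),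
    (forall i,
       represents (fun j => a (existT (fun i => real_index (R_sort i)) i j))
         (c i)) /\
    sat a (R_form R).

Definition heq_structure : structure heq_sig := {|
  carrier := heq_carrier : sorts heq_sig -> Type;
  fun_interp := fun (f : funs heq_sig) a => @fun_interp L M f a;
  rel_interp := fun r : rels heq_sig =>
    match r return
      (forall i, heq_carrier (@rel_dom heq_sig r i)) -> Prop
    with
    | inl r0 => fun a => @rel_interp L M r0 a
    | inr R => fun c => R_interp c
    end
|}.

Definition heq_theory (chi : h_inductive heq_sig) : Prop :=
  holds heq_structure chi.

End Hyperimaginaries.

Arguments heq_sig {L K M I} E.
Arguments heq_structure {L K M I} E.
Arguments heq_theory {L K M I} E chi.

(* Main.v *)
Require Import Defs.
From mathcomp Require Import all_boot.
From mathcomp Require Import boolp classical_sets.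

Set Implicit Arguments.
Unset Strict Implicit.
Unset Printing Implicit Defensive.

(** By saturation, each positive formula in hyperimaginary sorts, read on tuples
    of representatives, is equivalent in the monster model to a set of positive
    real formulas.  A tree for [phi] and [psi] in [T^E] lifts to representatives
    of its nodes.  As the sets defining [psi] and the instances of [phi] are
    jointly inconsistent, compactness yields single real formulas, in finitely
    many variables, which are already incompatible in the monster model, and by
    JCP and positive closedness in all models of [T]; they have the tree property
    along the representatives.  Conversely a real tree is a tree in [T^E], and
    its inconsistency is an h-inductive sentence. *)

(** * Small cardinals *)

Definition injects (A B : Type) : Prop := exists f : A -> B, injective f.

Lemma injects_trans (A B C : Type) : injects A B -> injects B C -> injects A C.
Proof. by move=> [f fI] [g gI]; exists (g \o f); exact: inj_comp. Qed.

(** By Zorn there is a maximal partial bijection between [A] and [B]. It is defined on all of [A] or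
    onto [B], since otherwise one more pair could be added. *)
Lemma injects_total (A B : Type) : injects A B \/ injects B A.
Proof.
pose P (G : set (A * B)) :=
  forall p q, G p -> G q -> (p.1 = q.1 <-> p.2 = q.2).
have [|G [PG maxG]] := @Zorn_bigcup _ P.
  move=> F FP Ftot p q [X FX Xp] [Y FY Yq].
  have [XY|YX] := Ftot _ _ FX FY.
    by apply: (FP _ FY) => //; exact: XY.
  by apply: (FP _ FX) => //; exact: YX.
have [allA|] := pselect (forall a, exists b, G (a, b)).
  left; have [f fP] := choice allA; exists f => a a' eq_f.
  exact: (PG _ _ (fP a) (fP a')).2.
move=> /existsNP[a0 na0].
have [allB|] := pselect (forall b, exists a, G (a, b)).
  right; have [f fP] := choice allB; exists f => b b' eq_f.
  exact: (PG _ _ (fP b) (fP b')).1.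
move=> /existsNP[b0 nb0]; exfalso.
have ltG : (G `<` G `|` [set (a0, b0)])%classic.
  split; first by move=> p; left.
  by move=> /(_ (a0, b0)) H; apply: na0; exists b0; apply: H; right.
apply: (maxG _ ltG) => -[a b] [a' b'] /= [Gp|[-> ->]] [Gq|[-> ->]] //=.
- exact: (PG _ _ Gp Gq).
- by split=> E; exfalso; [apply: na0; exists b|apply: nb0; exists a];
    rewrite -E.
- by split=> E; exfalso; [apply: na0; exists b'|apply: nb0; exists a'];
    rewrite E.
Qed.

Lemma sval_inj (T : Type) (P : T -> Prop) : injective (@proj1_sig T P).
Proof. by move=> [x ?] [y ?] /= e; exact: eq_exist. Qed.

(** A maximal [G] gives an injection of [D * bool] into [D]. By maximality the complement of [D]
    contains no copy of [D], so it injects into [D] by comparability. Hence [C] injects into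
    [D * bool], and so into [D]. *)
Lemma injects_double (C : Type) : injects nat C -> injects (C * bool) C.
Proof.
move=> natC.
(* [G] ranges over the graphs of injections [D * bool -> D] with [D] a subset
   of [C]. *)
pose P (G : set (C * bool * C)) :=
  (forall p q, G p -> G q -> (p.1 = q.1 <-> p.2 = q.2)) /\
  (forall x b z b', G (x, b, z) ->
     (exists z', G (x, b', z')) /\ (exists w, G (z, b', w))).
have [|G [[Ginj Gcl] maxG]] := @Zorn_bigcup _ P.
  move=> F FP Ftot; split=> [p q [X FX Xp] [Y FY Yq]|x b z b' [X FX Xp]].
    have [XY|YX] := Ftot _ _ FX FY.
      by apply: (FP _ FY).1 => //; exact: XY.
    by apply: (FP _ FX).1 => //; exact: YX.
  by have [[z' ?] [w ?]] := (FP _ FX).2 _ _ _ b' Xp;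
    split; [exists z'|exists w]; exists X.
pose D x := exists z, G (x, true, z).
have GD x b z : G (x, b, z) -> D x /\ D z.
  by move=> /Gcl-/(_ true).
(* A nonempty [B] that absorbs its own double and embeds outside [D] could be joined to [G]. *)
have Dmax (B : Type) (b0 : B) : injects (B * bool) B ->
    ~ injects B {x : C | ~ D x}.
  move=> [f fI] [i iI].
  have gI (u v : B) : sval (i u) = sval (i v) -> u = v.
    by move=> /sval_inj/iI.
  have gD (u : B) : ~ D (sval (i u)) := proj2_sig (i u).
  pose g u := sval (i u).
  pose G' := [set p | exists b c, p = (g b, c, g (f (b, c)))]%classic.
  have ltG : (G `<` G `|` G')%classic.
    split; first by move=> p; left.
    move=> /(_ (g b0, true, g (f (b0, true)))) H; apply: (gD b0).
    by exists (g (f (b0, true))); apply: H; right; exists b0, true.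
  apply: (maxG _ ltG); split.
    move=> p q [Gp|[b [c ->]]] [Gq|[b' [c' ->]]] /=.
    - exact: Ginj.
    - case: p Gp => -[x d] z /GD[Dx Dz] /=; split=> [[e _]|e]; exfalso.
        by apply: (gD b'); rewrite /g in e; rewrite -e.
      by apply: (gD (f (b', c'))); rewrite /g in e; rewrite -e.
    - case: q Gq => -[x d] z /GD[Dx Dz] /=; split=> [[e _]|e]; exfalso.
        by apply: (gD b); rewrite /g in e; rewrite e.
      by apply: (gD (f (b, c))); rewrite /g in e; rewrite e.
    - by split=> [[/gI-> ->]//|/gI/fI[-> ->]].
  move=> x b z b' [/Gcl-/(_ b')[[z' ?] [w ?]]|[u [c [-> _ ->]]]].
    by split; [exists z'|exists w]; left.
  by split; [exists (g (f (u, b')))|exists (g (f (f (u, c), b')))]; right;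
    [exists u, b'|exists (f (u, c)), b'].
(* If [D] were empty, the copy of [nat] in [C] would contradict [Dmax], through the injection
   sending $(m, b)$ to $2m + b$. *)
have [d0 Dd0] : exists d, D d.
  apply: contrapT => /forallNP nD; apply: (@Dmax nat 0).
    exists (fun p => nat_of_bool p.2 + p.1.*2) => -[m b] [n c] /= e.
    by rewrite -(half_bit_double m b) e half_bit_double; congr pair;
      move/(congr1 odd): e; rewrite !oddD !odd_double !addbF !oddb.
  case: natC => f fI; exists (fun n => exist _ (f n) (nD (f n))).
  by move=> m n [/fI].
have DD : injects ({x | D x} * bool) {x | D x}.
  have H (p : {x | D x} * bool) : exists z : {x | D x},
      G (sval p.1, p.2, sval z).
    case: p => -[x [z0 Gx]] b /=; have [[z Gz] _] := Gcl _ _ _ b Gx.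
    by exists (exist _ z (GD _ _ _ Gz).2).
  have [f fP] := choice H; exists f => -[[x Dx] b] [[y Dy] c] e.
  have := fP (exist _ x Dx, b); rewrite e => H1.
  have [_ /(_ erefl) /= [exy ->]] := Ginj _ _ H1 (fP (exist _ y Dy, c)).
  by congr pair; apply: eq_exist.
have RD : injects {x | ~ D x} {x | D x}.
  have [//|DR] := injects_total {x | ~ D x} {x | D x}.
  by have [] := Dmax _ (exist _ d0 Dd0) DD.
have CD : injects C {x | D x}.
  apply: injects_trans DD; case: RD => f fI.
  exists (fun x => match pselect (D x) with
                   | left p => (exist _ x p, true)
                   | right p => (f (exist _ x p), false) end).
  by move=> x y; case: pselect => p; case: pselect => q // => -[] // /fI[].
have : injects (C * bool) ({x | D x} * bool).
  by case: CD => f fI; exists (fun p => (f p.1, p.2)) => -[x b] [y c] [/fI-> ->].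
move=> /injects_trans; apply; apply: injects_trans DD _.
by exists sval; exact: sval_inj.
Qed.

Lemma injects_small (A B K : Type) :
  injects A B -> card_smaller B K -> card_smaller A K.
Proof.
move=> AB [BK KB]; split; first exact: injects_trans BK.
by move=> KA; apply: KB; exact: injects_trans AB.
Qed.

Lemma surjects_small (A B K : Type) (g : B -> A) :
  (forall a, exists b, g b = a) -> card_smaller B K -> card_smaller A K.
Proof.
move=> /choice[f fK]; apply: injects_small.
by exists f; exact: (can_inj fK).
Qed.

(** One of [A], [B] and [nat] receives injections from all three; call it [C]. Then [A + B] embeds
    into [C * bool], which embeds into the infinite type [C]. *)
Lemma small_sum (A B K : Type) : card_smaller nat K ->
  card_smaller A K -> card_smaller B K -> card_smaller (A + B) K.
Proof.
move=> nK AK BK.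
suff [C CK [natC AC BC]] : exists2 C, card_smaller C K &
    [/\ injects nat C, injects A C & injects B C].
  apply: injects_small CK; apply: injects_trans (injects_double natC).
  case: AC BC => f fI [g gI].
  exists (fun s => match s with inl a => (f a, true) | inr b => (g b, false) end).
  by move=> [a|b] [a'|b'] // [] => [/fI->|/gI->].
have refl T : injects T T by exists id.
have [D DK [AD BD]] : exists2 D, card_smaller D K & injects A D /\ injects B D.
  by have [AB|BA] := injects_total A B; [exists B|exists A].
have [nD|Dn] := injects_total nat D; first by exists D.
by exists nat => //; split=> //; apply: injects_trans Dn.
Qed.

Lemma small_finite (A K : Type) n (f : 'I_n -> A) : card_smaller nat K ->
  (forall a, exists i, f i = a) -> card_smaller A K.
Proof.
move=> nK fS; apply: surjects_small fS _; apply: injects_small nK.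
by exists (@nat_of_ord n); exact: ord_inj.
Qed.

Lemma small_ord_mul (A K : Type) n : card_smaller nat K -> card_smaller A K ->
  card_smaller ('I_n * A) K.
Proof.
move=> nK AK; elim: n => [|n IH].
  by apply: (small_finite (f := fun i : 'I_0 => match notF (ltn_ord i) with end))
    => // -[[]].
apply: (surjects_small (g := fun v : A + 'I_n * A =>
  match v with inl a => (ord0, a) | inr (i, a) => (lift ord0 i, a) end)).
  move=> [i a]; case: (unliftP ord0 i) => [j|] ->; last by exists (inl a).
  by exists (inr (j, a)).
exact: small_sum.
Qed.

(** * Substitution and existential closure *)

Lemma dep_choice (A : Type) (B : A -> Type) (P : forall a, B a -> Prop) :
  (forall a, exists b, P a b) -> exists f : forall a, B a, forall a, P a (f a).
Proof. by move=> H; exists (fun a => sval (cid (H a))) => a; case: cid. Qed.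

Lemma mem_pmap_classic (A B : Type) (f : A -> option B) (l : seq {classic A})
    (a : {classic A}) (b : {classic B}) :
  a \in l -> f a = Some b -> b \in (pmap f l : seq {classic B}).
Proof.
elim: l => //= c l IH; rewrite inE => /predU1P[->|al] fa.
  by rewrite fa /= mem_head.
by case: (f c) => [d|] /=; rewrite ?inE IH ?orbT.
Qed.

Section Substitution.

Variable L : signature.

Definition subst (V W : Type) (s : V -> sorts L) (s' : W -> sorts L) :=
  forall w, term s (s' w).

Fixpoint tsub V W (s : V -> sorts L) (s' : W -> sorts L) (f : subst s s') t
    (u : term s' t) : term s t :=
  match u with
  | Var w => f w
  | App g args => App (fun i => tsub f (args i))
  end.

Definition lift_subst V W (s : V -> sorts L) (s' : W -> sorts L) (t : sorts L)
    (f : subst s s') : subst (ext_sort t s) (ext_sort t s') :=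
  fun w => match w return term (ext_sort t s) (ext_sort t s' w) with
    | Some w' => tsub (fun v => Var (ext_sort t s) (Some v)) (f w')
    | None => Var (ext_sort t s) None
    end.

Fixpoint fsub V W (s : V -> sorts L) (s' : W -> sorts L) (f : subst s s')
    (phi : form s') : form s :=
  match phi with
  | Top => Top s
  | Bot => Bot s
  | Eq _ a b => Eq (tsub f a) (tsub f b)
  | Rel _ args => Rel (fun i => tsub f (args i))
  | And phi psi => And (fsub f phi) (fsub f psi)
  | Or phi psi => Or (fsub f phi) (fsub f psi)
  | Ex t phi => Ex (fsub (lift_subst t f) phi)
  end.

Definition sub_tup (N : structure L) V W (s : V -> sorts L) (s' : W -> sorts L)
    (f : subst s s') (a : tup N s) : tup N s' := fun w => eval a (f w).

Lemma eval_tsub (N : structure L) V W (s : V -> sorts L) (s' : W -> sorts L)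
    (f : subst s s') (a : tup N s) t (u : term s' t) :
  eval a (tsub f u) = eval (sub_tup f a) u.
Proof.
elim: u => //= g args IH; congr fun_interp.
by apply: functional_extensionality_dep => i; exact: IH.
Qed.

Lemma sat_fsub (N : structure L) W (s' : W -> sorts L) (phi : form s')
    V (s : V -> sorts L) (f : subst s s') (a : tup N s) :
  sat a (fsub f phi) <-> sat (sub_tup f a) phi.
Proof.
elim: phi V s f a =>
    {W s'} [W s'|W s'|W s' t u v|W s' r args|W s' p IHp q IHq|W s' p IHp q IHq|
            W s' t p IHp] //=.
- by move=> V s f a; rewrite !eval_tsub.
- move=> V s f a; suff -> : (fun i => eval a (tsub f (args i))) =
            (fun i => eval (sub_tup f a) (args i)) by [].
  by apply: functional_extensionality_dep => i; exact: eval_tsub.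
- by move=> V s f a; rewrite IHp IHq.
- by move=> V s f a; rewrite IHp IHq.
- move=> V s f a.
  have E c : sub_tup (lift_subst t f) (ext_tup c a) = ext_tup c (sub_tup f a).
    apply: functional_extensionality_dep => -[w|] //=.
    by rewrite /sub_tup /= eval_tsub.
  by split=> -[c Hc]; exists c; move: Hc; rewrite IHp E.
Qed.

Definition vars (V W : Type) (s : V -> sorts L) (g : W -> V) :
  subst s (s \o g) := fun w => Var s (g w).

Lemma sub_vars (N : structure L) (V W : Type) (s : V -> sorts L) (g : W -> V)
    (a : tup N s) : sub_tup (vars s g) a = (fun w => a (g w)).
Proof. by []. Qed.

Definition big_and (n : nat) V (s : V -> sorts L) (phi : 'I_n -> form s) :=
  foldr (fun i => And (phi i)) (Top s) (enum 'I_n).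

Lemma sat_big_and (N : structure L) n V (s : V -> sorts L) (phi : 'I_n -> form s)
    (a : tup N s) : sat a (big_and phi) <-> forall i, sat a (phi i).
Proof.
rewrite /big_and; have : forall i : 'I_n, i \in enum 'I_n by move=> i; rewrite mem_enum.
move: (enum 'I_n) => l lP; transitivity (forall i, i \in l -> sat a (phi i)).
  elim: l {lP} => [|j l [IH1 IH2]] /=; first by split.
  split=> [[Hj /IH1 Hl] i|H].
    by rewrite inE => /predU1P[->|/Hl].
  by split; [|apply: IH2 => i il]; apply: H; rewrite inE ?il ?eqxx ?orbT.
by split=> H i; [exact: H|].
Qed.

(** * Finite supports and quantification over tuples *)

Lemma term_support V (s : V -> sorts L) t (u : term s t) :
  exists l : seq {classic V}, forall W (g : W -> V),
    (forall v : {classic V}, v \in l -> exists w, g w = v) ->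
    exists u' : term (s \o g) t, u = tsub (vars s g) u'.
Proof.
elim: u => [v|f args IH].
  exists [:: v] => W g /(_ v); rewrite inE eqxx => /(_ erefl)[w <-].
  by exists (Var (s \o g) w).
have [l lP] := dep_choice IH; exists (flatten [seq l i | i <- enum 'I_(fun_arity f)]).
move=> W g gP.
have H i : exists u' : term (s \o g) (fun_dom i), args i = tsub (vars s g) u'.
  apply: lP => v vl; apply: gP; apply/flattenP; exists (l i) => //.
  by apply: map_f; rewrite mem_enum.
have [args' E] := dep_choice H; exists (App args') => /=; congr App.
exact: functional_extensionality_dep.
Qed.

(** The list [l] collects the free variables that occur. Asking for a restriction along every [g]
    that covers [l] lets the induction concatenate supports and pass below a quantifier, with
    [omap g] in place of [g]. *)
Lemma finite_support V (s : V -> sorts L) (phi : form s) :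
  exists l : seq {classic V}, forall W (g : W -> V),
    (forall v : {classic V}, v \in l -> exists w, g w = v) ->
    exists phi' : form (s \o g), forall (N : structure L) (a : tup N s),
      sat a phi <-> sat (M := N) (s := s \o g) (fun w => a (g w)) phi'.
Proof.
elim: phi => {V s} [V s|V s|V s t u v|V s r args|V s p IHp q IHq|V s p IHp q IHq|V s t p IHp].
- by exists [::] => W g _; exists (Top _).
- by exists [::] => W g _; exists (Bot _).
- have [[l lP] [l' l'P]] := (term_support u, term_support v).
  exists (l ++ l') => W g gP.
  have [w wl|u' ->] := lP W g; first by apply: gP; rewrite mem_cat wl.
  have [w wl|v' ->] := l'P W g; first by apply: gP; rewrite mem_cat wl orbT.
  by exists (Eq u' v') => N a /=; rewrite !eval_tsub sub_vars.
- have [l lP] := dep_choice (fun i => term_support (args i)).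
  exists (flatten [seq l i | i <- enum 'I_(rel_arity r)]) => W g gP.
  have H i : exists u' : term (s \o g) (rel_dom i), args i = tsub (vars s g) u'.
    apply: lP => v vl; apply: gP; apply/flattenP; exists (l i) => //.
    by apply: map_f; rewrite mem_enum.
  have [args' E] := dep_choice H; exists (Rel args') => N a /=.
  suff -> : (fun i => eval a (args i)) =
            (fun i => eval (M := N) (s := s \o g) (fun w => a (g w)) (args' i)) by [].
  by apply: functional_extensionality_dep => i; rewrite E eval_tsub.
- have [[l lP] [l' l'P]] := (IHp, IHq).
  exists (l ++ l') => W g gP.
  have [w wl|p' p'P] := lP W g; first by apply: gP; rewrite mem_cat wl.
  have [w wl|q' q'P] := l'P W g; first by apply: gP; rewrite mem_cat wl orbT.
  by exists (And p' q') => N a /=; rewrite p'P q'P.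
- have [[l lP] [l' l'P]] := (IHp, IHq).
  exists (l ++ l') => W g gP.
  have [w wl|p' p'P] := lP W g; first by apply: gP; rewrite mem_cat wl.
  have [w wl|q' q'P] := l'P W g; first by apply: gP; rewrite mem_cat wl orbT.
  by exists (Or p' q') => N a /=; rewrite p'P q'P.
(* [pmap id] drops the bound variable [None] from the support of the body. *)
have [l lP] := IHp; exists (pmap id l).
move=> W g gP.
have [[v|] vl|p' p'P] := lP _ (omap g).
- have [|w <-] := gP v; last by exists (Some w).
  exact: mem_pmap_classic vl _.
- by exists None.
(* This renaming fixes every variable: the two sort assignments agree pointwise, but not by
   conversion. *)
pose f : subst (ext_sort t (s \o g)) (ext_sort t s \o omap g) := fun w =>
  match w return term (ext_sort t (s \o g)) (ext_sort t s (omap g w)) with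
  | Some w' => Var (ext_sort t (s \o g)) (Some w')
  | None => Var (ext_sort t (s \o g)) None
  end.
exists (Ex (fsub f p')) => N a /=.
have E c : sub_tup f (ext_tup (s := s \o g) c (fun w => a (g w))) =
    (fun w => ext_tup c a (omap g w)).
  by apply: functional_extensionality_dep => -[].
by split=> -[c Hc]; exists c; move: Hc; rewrite p'P sat_fsub E.
Qed.

(** Duplicates are removed because [extend_tup] requires an injective enumeration. *)
Lemma enum_seq (V : Type) (l : seq {classic V}) :
  exists n (f : 'I_n -> V), injective f /\
    forall v : {classic V}, v \in l -> exists i, f i = v.
Proof.
exists (size (undup l)), (tnth (in_tuple (undup l))); split.
  by apply/(tuple_uniqP (in_tuple (undup l))); exact: undup_uniq.
by move=> v; rewrite -mem_undup => /(tnthP (in_tuple _))[i ->]; exists i.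
Qed.

(** The tuple [a] supplies default values off the image of [g]; on the image, injectivity makes the
    prescribed value unambiguous. *)
Lemma extend_tup (N : structure L) V W (s : V -> sorts L) (g : W -> V)
    (a : tup N s) (b : tup N (s \o g)) :
  injective g -> exists a' : tup N s, (fun w => a' (g w)) = b.
Proof.
move=> gI.
have H v : exists c : N (s v), forall w (e : g w = v),
    c = eq_rect _ (fun v => N (s v)) (b w) _ e.
  have [[w e]|n] := pselect (exists w, g w = v).
    exists (eq_rect _ (fun v => N (s v)) (b w) _ e) => w' e'.
    have ew : w = w' := gI _ _ (etrans e (esym e')).
    by case: _ / ew in e' *; rewrite (Prop_irrelevance e' e).
  by exists (a v) => w e; case: n; exists w.
have [a' a'P] := dep_choice H; exists a'.
by apply: functional_extensionality_dep => w; rewrite (a'P _ w erefl).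
Qed.

(** Variables are bound one at a time: [ord0] becomes the bound variable [None] of the outermost
    quantifier, and induction binds the others inside it. *)
Lemma ex_ordinal n (x : 'I_n -> sorts L) W (y : W -> sorts L)
    (phi : form (cat_sort x y)) :
  exists chi : form y, forall (N : structure L) (b : tup N y),
    sat b chi <-> exists a : tup N x, sat (cat_tup a b) phi.
Proof.
elim: n x W y phi => [|n IH] x W y phi.
  pose f : subst y (cat_sort x y) := fun v =>
    match v return term y (cat_sort x y v) with
    | inl i => match notF (ltn_ord i) with end
    | inr w => Var y w
    end.
  exists (fsub f phi) => N b; rewrite sat_fsub.
  have E (a : tup N x) : sub_tup f b = cat_tup a b.
    by apply: functional_extensionality_dep => -[[]|].
  have a0 : tup N x by case.
  by rewrite (E a0); split=> [H|[a]]; [exists a0|rewrite -!E].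
pose x' := x \o lift ord0; pose y' := ext_sort (x ord0) y.
pose val N (a : tup N x) (b : tup N y) : tup N (cat_sort x' y') :=
  cat_tup (s := x') (fun i => a (lift ord0 i)) (ext_tup (a ord0) b).
(* The substitution is characterised by its values, which avoids a dependent match on whether an
   index is [ord0] or a lift. *)
have H v : exists u : term (cat_sort x' y') (cat_sort x y v),
    forall N (a : tup N x) (b : tup N y), eval (val N a b) u = cat_tup a b v.
  case: v => [i|w] /=; last by exists (Var (cat_sort x' y') (inr (Some w))).
  case: (unliftP ord0 i) => [j|] ->.
    by exists (Var (cat_sort x' y') (inl j)).
  by exists (Var (cat_sort x' y') (inr None)).
have [f fP] := dep_choice H.
have [chi chiP] := IH _ _ _ (fsub f phi).
exists (Ex chi) => N b /=; split=> [[c /chiP[a' Ha']]|[a Ha]].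
  (* The tuple is reassembled from [c] at [ord0] and [a'] at the lifts; transports account for the
     sort depending on the index. *)
  have G i : exists e : N (x i),
      (forall j (q : lift ord0 j = i), e = eq_rect _ (fun i => N (x i)) (a' j) _ q)
      /\ (forall q : ord0 = i, e = eq_rect _ (fun i => N (x i)) c _ q).
    case: (unliftP ord0 i) => [j|] ->.
      exists (a' j); split=> [k q|q]; last by case: (negP (neq_lift ord0 j)); apply/eqP.
      have ejk : j = k := lift_inj (esym q).
      by case: _ / ejk in q *; rewrite (Prop_irrelevance q erefl).
    exists c; split=> [k q|q]; first by case: (negP (neq_lift ord0 k)); apply/eqP.
    by rewrite (Prop_irrelevance q erefl).
  have [a aP] := dep_choice G; exists a.
  have E : cat_tup a' (ext_tup c b) = val N a b.
    rewrite /val (proj2 (aP ord0) erefl) /=; congr cat_tup.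
    by apply: functional_extensionality_dep => j; rewrite (proj1 (aP _) j erefl).
  move: Ha'; rewrite sat_fsub E.
  suff -> : sub_tup f (val N a b) = cat_tup a b by [].
  by apply: functional_extensionality_dep => v; rewrite -fP.
exists (a ord0); apply/chiP; exists (fun i => a (lift ord0 i)).
rewrite sat_fsub; suff -> : sub_tup f (val N a b) = cat_tup a b by [].
by apply: functional_extensionality_dep => v; rewrite -fP.
Qed.

(** Nonemptiness is needed because [x] may mention an empty sort in a variable
    that does not occur in [phi]. *)
Lemma ex_form V W (x : V -> sorts L) (y : W -> sorts L)
    (phi : form (cat_sort x y)) :
  exists chi : form y, forall (N : structure L) (b : tup N y),
    inhabited (tup N x) ->
    (sat b chi <-> exists a : tup N x, sat (cat_tup a b) phi).
Proof.
have [l lP] := finite_support phi.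
have [n [f [fI fP]]] := enum_seq
  (pmap (fun v => match v with inl v => Some v | inr _ => None end) l).
pose g (v : 'I_n + W) : V + W := match v with inl i => inl (f i) | inr w => inr w end.
have [|phi' phi'P] := lP _ g.
  move=> [v|w] vl; last by exists (inr w).
  have [|i fi] := fP v; last by exists (inl i); rewrite /g fi.
  exact: mem_pmap_classic vl _.
pose h : subst (cat_sort (x \o f) y) (cat_sort x y \o g) := fun v =>
  match v return term (cat_sort (x \o f) y) (cat_sort x y (g v)) with
  | inl i => Var (cat_sort (x \o f) y) (inl i)
  | inr w => Var (cat_sort (x \o f) y) (inr w)
  end.
have [chi chiP] := ex_ordinal (fsub h phi').
exists chi => N b [a0]; rewrite chiP.
have E (a : tup N x) : sub_tup h (cat_tup (s := x \o f) (fun i => a (f i)) b) =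
    (fun v => cat_tup a b (g v)).
  by apply: functional_extensionality_dep => -[].
split=> [[a' Ha']|[a Ha]]; last first.
  by exists (fun i => a (f i)); rewrite sat_fsub E -phi'P.
(* Coordinates outside the enumerated support take their values from [a0]. *)
have [a ea] := extend_tup a0 a' fI; exists a.
by rewrite phi'P -E ea -sat_fsub.
Qed.

End Substitution.

(** * Real formulas in the hyperimaginary signature *)

(** This is the configuration that the inconsistency clause of [tree_property] excludes. *)
Definition sat_array (L : signature) (N : structure L) k V W
    (x : V -> sorts L) (y : W -> sorts L) (phi : form (cat_sort x y))
    (psi : form (fun p : 'I_k * W => y p.2)) :=
  exists b : 'I_k -> tup N y,
    sat (M := N) (s := fun p : 'I_k * W => y p.2) (fun p => b p.1 p.2) psi /\
    exists c : tup N x, forall j, sat (cat_tup c (b j)) phi.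

(** The solution and all [k] rows form one tuple, which is quantified at once. With [s] empty the
    configuration becomes a positive sentence, to which h-inductive axioms and positive closedness
    apply. *)
Lemma sat_array_form (L : signature) k V W U (x : V -> sorts L)
    (y : W -> sorts L) (s : U -> sorts L) (phi : form (cat_sort x y))
    (psi : form (fun p : 'I_k * W => y p.2)) :
  exists chi : form s, forall N : structure L,
    inhabited (tup N x) -> inhabited (tup N y) ->
    forall e : tup N s, sat e chi <-> sat_array N phi psi.
Proof.
pose y' (p : 'I_k * W) := y p.2.
pose z := cat_sort (cat_sort x y') s.
pose f : subst z y' := fun p => Var z (inl (inr p)).
pose g j : subst z (cat_sort x y) := fun v =>
  match v return term z (cat_sort x y v) with
  | inl i => Var z (inl (inl i))
  | inr i => Var z (inl (inr (j, i)))
  end.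
have [chi chiP] := ex_form (And (fsub f psi) (big_and (fun j => fsub (g j) phi))).
exists chi => N [x0] [y0] e.
have gE c (b : 'I_k -> tup N y) j :
    sub_tup (g j) (cat_tup (cat_tup (s' := y') c (fun p => b p.1 p.2)) e) =
    cat_tup c (b j).
  by apply: functional_extensionality_dep => -[].
rewrite chiP; last by constructor; exact: cat_tup x0 (fun p => y0 p.2).
split=> [[a /= [/sat_fsub Hpsi /sat_big_and Hphi]]|[b [Hb [c Hc]]]].
  exists (fun j i => a (inr (j, i))); split.
    suff <- : sub_tup f (cat_tup a e) = (fun p => a (inr (p.1, p.2))) by [].
    by apply: functional_extensionality_dep => -[].
  exists (fun i => a (inl i)) => j.
  rewrite -(gE (fun i => a (inl i)) (fun j i => a (inr (j, i)))).
  suff <- : a = cat_tup (s' := y') (fun i => a (inl i)) (fun p => a (inr (p.1, p.2))).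
    exact/sat_fsub/Hphi.
  by apply: functional_extensionality_dep => -[|[]].
exists (cat_tup (s' := y') c (fun p => b p.1 p.2)); split.
  by apply/sat_fsub.
by apply/sat_big_and => j; apply/sat_fsub; rewrite gE.
Qed.

Section Reals.

Variables (L : signature) (K : Type) (M : structure L) (I : Type)
  (E : I -> type_def_equiv K M).

Let H := heq_structure E.

Definition in_heq V (s : V -> sorts L) : V -> sorts (heq_sig E) :=
  fun v => inl (s v).

Fixpoint heq_term V (s : V -> sorts L) t (u : term s t) :
    term (in_heq s) (inl t) :=
  match u with
  | Var v => Var (in_heq s) v
  | App f args => App (L := heq_sig E) (f := f) (fun i => heq_term (args i))
  end.

(** The identity on variables, mediating between two sort assignments that agree only pointwise. *)
Definition ext_in_heq V (s : V -> sorts L) (t : sorts L) :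
    subst (ext_sort (inl t : sorts (heq_sig E)) (in_heq s)) (in_heq (ext_sort t s)) :=
  fun v => match v return term (ext_sort (inl t : sorts (heq_sig E)) (in_heq s))
                            (in_heq (ext_sort t s) v) with
    | Some w => Var (ext_sort (inl t : sorts (heq_sig E)) (in_heq s)) (Some w)
    | None => Var (ext_sort (inl t : sorts (heq_sig E)) (in_heq s)) None
    end.

Fixpoint heq_form V (s : V -> sorts L) (phi : form s) : form (in_heq s) :=
  match phi with
  | Top => Top _
  | Bot => Bot _
  | Eq _ a b => Eq (heq_term a) (heq_term b)
  | Rel r args =>
      Rel (L := heq_sig E) (r := inl r) (fun i => heq_term (args i))
  | And p q => And (heq_form p) (heq_form q)
  | Or p q => Or (heq_form p) (heq_form q)
  | Ex t p => Ex (fsub (@ext_in_heq V s t) (heq_form p))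
  end.

Lemma eval_heq V (s : V -> sorts L) t (u : term s t) (a : tup M s) :
  eval (M := H) (s := in_heq s) a (heq_term u) = eval a u.
Proof.
elim: u => //= f args IH; congr fun_interp.
exact: functional_extensionality_dep.
Qed.

(** On real sorts the expansion has the elements, functions and relations of [M] by definition, so
    [a] serves as a tuple of both structures. *)
Lemma sat_heq V (s : V -> sorts L) (phi : form s) (a : tup M s) :
  sat (M := H) (s := in_heq s) a (heq_form phi) <-> sat a phi.
Proof.
elim: phi a => {V s} [V s|V s|V s t u v|V s r args|V s p IHp q IHq|
                      V s p IHp q IHq|V s t p IHp] a //=.
- by rewrite !eval_heq.
- suff -> : (fun i => eval (M := H) (s := in_heq s) a (heq_term (args i))) =
            (fun i => eval a (args i)) by [].
  by apply: functional_extensionality_dep => i; exact: eval_heq.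
- by rewrite IHp IHq.
- by rewrite IHp IHq.
pose a' : tup H (in_heq s) := a.
have eq_ext (c : M t) : sub_tup (@ext_in_heq V s t)
    (@ext_tup _ H V (inl t) (in_heq s) c a') = @ext_tup L M V t s c a.
  by apply: functional_extensionality_dep => -[].
by split=> -[c Hc]; exists c; move: Hc; rewrite sat_fsub eq_ext IHp.
Qed.

Lemma tree_property_heq (T : h_inductive L -> Prop) : model T M ->
  tree_property T M -> tree_property (heq_theory E) H.
Proof.
move=> TM [m [n [x [y [phi [k [psi [a [k2 [incon [con psiP]]]]]]]]]]].
pose z := cat_sort (in_heq x) (in_heq y).
pose f : subst z (in_heq (cat_sort x y)) := fun v =>
  match v return term z (in_heq (cat_sort x y) v) with
  | inl i => Var z (inl i)
  | inr i => Var z (inr i)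
  end.
have fE (c : tup M x) (b : tup M y) :
    sub_tup f (cat_tup (M := H) (s := in_heq x) (s' := in_heq y) c b) =
    cat_tup c b.
  by apply: functional_extensionality_dep => -[].
exists m, n, (in_heq x), (in_heq y), (fsub f (heq_form phi)), k, (heq_form psi), a.
split=> //; split; last first.
  split=> [sigma|eta i ltI]; last by apply/sat_heq; exact: psiP.
  have [c cP] := con sigma.
  by exists c => l; apply/sat_fsub; rewrite fE; apply/sat_heq.
pose s0 : 'I_0 -> sorts (heq_sig E) := fun i => match notF (ltn_ord i) with end.
have [chi chiP] := sat_array_form s0 (fsub f (heq_form phi)) (heq_form psi).
(* Any branch will do: its solution [c0] shows that the sorts of [x] are inhabited. *)
have [c0 _] := con id.
(* As [M] is a model of [T], it contains no such array. The sentence is therefore true in the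
   expansion, hence an axiom of $T^{\mathcal E}$, and every model of $T^{\mathcal E}$ inherits the
   inconsistency. *)
have Tchi : heq_theory E (HInductive chi (Bot s0)).
  move=> e /chiP[||b [Hb [c Hc]]]; first by constructor.
    by constructor; exact: (a [::]).
  apply: (incon M TM); exists b; split; first exact/sat_heq.
  by exists c => j; apply/sat_heq; rewrite -fE; exact/sat_fsub.
move=> N modN [b [Hb [c Hc]]].
have e0 : tup N s0 by case.
have j0 : 'I_k by apply: Ordinal (ltnW k2).
have [] := modN _ Tchi e0; apply/chiP; [by constructor|by constructor; exact: b j0|].
by exists b; split=> //; exists c.
Qed.

End Reals.

(** * Type-definability *)

Section TypeDefinable.

Variables (L : signature) (K : Type) (M : structure L).
Hypothesis satM : saturated K M.

Definition entails V (s : V -> sorts L) (P : tup M s -> Prop) (phi : form s) :=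
  forall b, P b -> sat b phi.

(** [P] is defined by some set of formulas if and only if it is defined by the
    set of all its consequences. *)
Definition type_def V (s : V -> sorts L) (P : tup M s -> Prop) :=
  forall a, (forall phi, entails P phi -> sat a phi) -> P a.

Lemma type_def_sat V (s : V -> sorts L) (phi : form s) :
  type_def (fun a : tup M s => sat a phi).
Proof. by move=> a; apply. Qed.

Lemma type_def_iff V (s : V -> sorts L) (P Q : tup M s -> Prop) :
  type_def P -> (forall a, P a <-> Q a) -> type_def Q.
Proof.
by move=> clP PQ a aQ; apply/PQ/clP => phi Pphi; apply: aQ => b /PQ/Pphi.
Qed.

Lemma type_def_forall J V (s : V -> sorts L) (P : J -> tup M s -> Prop) :
  (forall j, type_def (P j)) -> type_def (fun a => forall j, P j a).
Proof.
move=> clP a aP j; apply: clP => phi Pphi; apply: aP => b Pb.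
exact/Pphi/Pb.
Qed.

Lemma type_def_and V (s : V -> sorts L) (P Q : tup M s -> Prop) :
  type_def P -> type_def Q -> type_def (fun a => P a /\ Q a).
Proof.
move=> clP clQ a aPQ; split; [apply: clP|apply: clQ] => phi Hphi;
  apply: aPQ => b [] Pb Qb; exact: Hphi.
Qed.

(** Disjunctions of consequences of [P] and of [Q] are consequences of the union. If some
    consequence of [Q] fails at [a], all those of [P] must hold there. *)
Lemma type_def_or V (s : V -> sorts L) (P Q : tup M s -> Prop) :
  type_def P -> type_def Q -> type_def (fun a => P a \/ Q a).
Proof.
move=> clP clQ a aPQ; have [?|nP] := pselect (P a); [by left|right].
apply: clQ => psi Qpsi; apply: contrapT => npsi; apply: nP.
apply: clP => phi Pphi.
by have [|//|//] := aPQ (Or phi psi); move=> b [/Pphi|/Qpsi]; [left|right].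
Qed.

Lemma type_def_sub V W (s : V -> sorts L) (s' : W -> sorts L) (f : subst s s')
    (P : tup M s' -> Prop) : type_def P -> type_def (fun a => P (sub_tup f a)).
Proof.
move=> clP a aP; apply: clP => phi Pphi; apply/sat_fsub; apply: aP => b /Pphi.
by move=> ?; apply/sat_fsub.
Qed.

(** A finite conjunction of consequences of [P], existentially closed, is a consequence of the
    projection. So the consequences of [P] are finitely satisfiable over [b], and saturation
    realises them together. *)
Lemma type_def_ex V W (x : V -> sorts L) (y : W -> sorts L)
    (P : tup M (cat_sort x y) -> Prop) :
  card_smaller V K -> card_smaller W K -> type_def P ->
  type_def (fun b : tup M y => exists a : tup M x, P (cat_tup a b)).
Proof.
move=> VK WK clP b bP.
(* If a sort of [x] is empty, the projection is empty and [Bot] is one of its consequences. *)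
have [x0|nx] := pselect (inhabited (tup M x)); last first.
  by case: (bP (Bot y)) => b' [a _]; case: nx.
have [|a aP] := satM VK WK (b := b) (Sigma := entails P); last first.
  by exists a; exact: clP.
move=> n phi Hphi; have [chi chiP] := ex_form (big_and phi).
have /chiP-/(_ x0)[a /sat_big_and aphi] : sat b chi; last by exists a.
apply: bP => b' [a Pa]; apply/chiP => //; exists a; apply/sat_big_and => i.
exact: Hphi.
Qed.

End TypeDefinable.

Arguments type_def_sat {L M V s} phi.

(** * Representatives of hyperimaginary tuples *)

Section Hyperimaginary.

Variables (L : signature) (K : Type) (M : structure L) (I : Type)
  (E : I -> type_def_equiv K M).
Hypotheses (satM : saturated K M) (natK : card_smaller nat K).

Let S := heq_sig E.
Let H := heq_structure E.

Definition cls (u : heq_sorts L I) :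
    (forall j : real_index E u, M (real_sort j)) -> heq_carrier E u :=
  match u with
  | inl t => fun a => a tt
  | inr i => fun a =>
      exist _ (defined_rel (@tde_forms L K M (E i)) a) (ex_intro _ a erefl)
  end.

Lemma cls_surj (u : heq_sorts L I) (c : heq_carrier E u) :
  exists a, cls a = c.
Proof.
case: u c => [t c|i [C [a Ca]]]; first by exists (fun _ => c).
by exists a; exact: eq_exist.
Qed.

Lemma cls_eq (i : I) (a b : tup M (@tde_sort L K M (E i))) :
  cls (u := inr i) a = cls (u := inr i) b <->
  defined_rel (@tde_forms L K M (E i)) a b.
Proof.
have [refl sym trans] := tde_equiv (E i).
split=> [[->]|ab]; first exact: refl.
apply: eq_exist; apply: functional_extensionality_dep => c.
by apply: propext; split; apply: trans => //; exact: sym.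
Qed.

Lemma represents_cls (u : heq_sorts L I) (a : forall j : real_index E u, M (real_sort j))
    (c : heq_carrier E u) : represents a c <-> cls a = c.
Proof.
case: u a c => [t|i] a; first by [].
move=> c; have [b <-] := cls_surj c; rewrite cls_eq /=.
have [refl sym trans] := tde_equiv (E i).
by split; exact: sym.
Qed.

(** The variables of $x_r$ for an arbitrary index type: [real_tuple_sort] covers only ['I_n], while
    binders and concatenation lead to [option V] and sums. *)
Definition real_var V (s : V -> sorts S) := {v : V & real_index E (s v)}.

Definition rsort V (s : V -> sorts S) (v : real_var s) : sorts L :=
  real_sort (projT2 v).

Definition rvar V (s : V -> sorts S) v (j : real_index E (s v)) :
  real_var s := existT (fun v => real_index E (s v)) v j.
Arguments rvar : clear implicits.

Definition heq_tup V (s : V -> sorts S) (a : tup M (@rsort V s)) : tup H s :=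
  fun v => cls (fun j => a (rvar _ s v j)).

Lemma heq_tup_surj V (s : V -> sorts S) (c : tup H s) :
  exists a, heq_tup a = c.
Proof.
have [a aP] := dep_choice (fun v => cls_surj (c v)).
exists (fun v => a (projT1 v) (projT2 v)).
by apply: functional_extensionality_dep => v; rewrite -aP.
Qed.

(** On a real sort this is an equation; on a sort of classes it is an instance of the formulas that
    define the equivalence relation. *)
Lemma type_def_cls_eq (u : heq_sorts L I) W (s : W -> sorts L)
    (f g : forall j : real_index E u, term s (real_sort j)) :
  type_def (fun a : tup M s =>
    cls (fun j => eval a (f j)) = cls (fun j => eval a (g j))).
Proof.
case: u f g => [t|i] f g; first exact: type_def_sat (Eq (f tt) (g tt)).
pose h : subst s (cat_sort (@tde_sort L K M (E i)) (@tde_sort L K M (E i))) :=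
  fun v => match v return term s (cat_sort _ _ v) with inl j => f j | inr j => g j end.
have cl : type_def (fun a : tup M s => forall phi,
    @tde_forms L K M (E i) phi -> sat (sub_tup h a) phi).
  apply: type_def_forall => phi; apply: type_def_forall => _.
  by apply: (type_def_sub (f := h) (P := fun b => sat b phi)); exact: type_def_sat.
apply: type_def_iff cl _ => a; rewrite cls_eq.
suff -> : sub_tup h a = cat_tup (fun j => eval a (f j)) (fun j => eval a (g j)) by [].
by apply: functional_extensionality_dep => -[].
Qed.

(** Function symbols have real sorts only, so a term of hyperimaginary sort is a variable and its
    representatives are real variables. *)
Lemma heq_term_real V (s : V -> sorts S) t (u : term s t) :
  exists f : forall j : real_index E t, term (@rsort V s) (real_sort j),
    forall a, eval (heq_tup a) u = cls (fun j => eval a (f j)).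
Proof.
elim: u => [v|f args IH]; first by exists (fun j => Var (@rsort V s) (rvar _ s v j)).
have [g gP] := dep_choice IH.
exists (fun _ => App (L := L) (f := f) (fun i => g i tt)) => a /=; congr fun_interp.
by apply: functional_extensionality_dep => i; exact: gP.
Qed.

Lemma small_real_var_ext V (s : V -> sorts S) (t : sorts S) :
  card_smaller (real_var s) K -> card_smaller (real_index E t) K ->
  card_smaller (real_var (ext_sort t s)) K.
Proof.
move=> sK tK; apply: (surjects_small (B := real_index E t + real_var s)
  (g := fun v => match v with
     | inl j => rvar _ (ext_sort t s) None j
     | inr (existT v j) => rvar _ (ext_sort t s) (Some v) j end)).
  by move=> [[v|] j]; [exists (inr (rvar _ s v j))|exists (inl j)].
exact: small_sum.
Qed.

Lemma small_real_index (t : sorts S) : card_smaller (real_index E t) K.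
Proof.
case: t => [t|i]; last exact: tde_small.
by apply: (small_finite (f := fun _ : 'I_1 => tt)) => // -[]; exists ord0.
Qed.

(** A finite tuple is replaced by finitely many small blocks of real variables. The case of ['I_n]
    is by induction, and [enum_val] reduces other finite index types to it. *)
Lemma small_real_var (V : finType) (s : V -> sorts S) :
  card_smaller (real_var s) K.
Proof.
have ordK n (s' : 'I_n -> sorts S) : card_smaller (real_var s') K.
  elim: n s' => [|n IH] s'.
    by apply: (small_finite (f := fun i : 'I_0 => match notF (ltn_ord i) with end))
      => // -[[]].
  apply: (surjects_small (g := fun v : real_var (ext_sort (s' ord0) (s' \o lift ord0)) =>
    match v with
    | existT None j => rvar _ s' ord0 j
    | existT (Some i) j => rvar _ s' (lift ord0 i) j
    end)).
    move=> [i]; case: (unliftP ord0 i) => [k|] -> j.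
      by exists (rvar _ (ext_sort (s' ord0) (s' \o lift ord0)) (Some k) j).
    by exists (rvar _ (ext_sort (s' ord0) (s' \o lift ord0)) None j).
  exact/small_real_var_ext/small_real_index.
apply: (surjects_small (g := fun v : real_var (s \o enum_val (A := V)) =>
    rvar _ s _ (projT2 v))); last exact: ordK.
move=> [v]; rewrite -(enum_rankK v) => j.
by exists (rvar _ (s \o enum_val (A := V)) _ j).
Qed.

(** For [R_phi] and for quantifiers, the witnessing representatives come from
    saturation. *)
Lemma type_def_heq_sat V (s : V -> sorts S) (phi : form s) :
  card_smaller (real_var s) K ->
  type_def (fun a : tup M (@rsort V s) => sat (heq_tup a) phi).
Proof.
elim: phi => {V s} [V s|V s|V s t u v|V s [r|R] args|V s p IHp q IHq|
                    V s p IHp q IHq|V s t p IHp] sK.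
- exact: type_def_sat (Top _).
- exact: type_def_sat (Bot _).
- have [f fP] := heq_term_real u; have [g gP] := heq_term_real v.
  apply: type_def_iff (type_def_cls_eq (f := f) (g := g)) _ => a.
  by rewrite /= fP gP.
- have [f fP] := dep_choice (fun i => heq_term_real (args i)).
  apply: type_def_iff (type_def_sat (Rel (L := L) (r := r) (fun i => f i tt))) _ => a /=.
  suff -> : (fun i => eval (heq_tup a) (args i)) = (fun i => eval a (f i tt)) by [].
  by apply: functional_extensionality_dep => i; exact: fP.
- have [f fP] := dep_choice (fun i => heq_term_real (args i)).
  pose y := @real_tuple_sort L K M I E _ (@R_sort _ _ _ _ E R).
  (* The context [z] joins candidate representatives to the given real tuple. [f1] reads the classes
     of the candidates and [f2] the arguments of [R], which have to agree. *)
  pose z := cat_sort y (@rsort V s).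
  pose f1 i (j : real_index E (R_sort i)) : term z (real_sort j) :=
    Var z (inl (existT (fun i => real_index E (R_sort i)) i j)).
  pose g : subst z (@rsort V s) := fun v => Var z (inr v).
  pose f2 i (j : real_index E (R_sort i)) : term z (real_sort j) :=
    tsub g (f i j).
  pose h : subst z y := fun v => Var z (inl v).
  have yK : card_smaller {i : 'I_(R_arity R) & real_index E (R_sort i)} K.
    exact: (@small_real_var _ (@R_sort _ _ _ _ E R)).
  have cl : type_def (fun c : tup M z =>
      (forall i, cls (fun j => eval c (f1 i j)) = cls (fun j => eval c (f2 i j))) /\
      sat c (fsub h (R_form R))).
    apply: type_def_and; last exact: type_def_sat.
    by apply: type_def_forall => i; exact: type_def_cls_eq.
  apply: type_def_iff (type_def_ex satM yK sK cl) _ => a.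
  have E2 c i : cls (fun j => eval (cat_tup c a) (f2 i j)) = eval (heq_tup a) (args i).
    rewrite fP; congr cls; apply: functional_extensionality_dep => j.
    by rewrite eval_tsub.
  split=> [[c [c1 c2]]|[c [c1 c2]]]; exists c; split.
  + by move=> i; apply/represents_cls; rewrite -(E2 c) -c1.
  + by move: c2; rewrite sat_fsub.
  + by move=> i; rewrite E2; exact/represents_cls.
  + by rewrite sat_fsub.
- exact: type_def_and (IHp sK) (IHq sK).
- exact: type_def_or (IHp sK) (IHq sK).
(* Quantifying over an element amounts to quantifying over its representatives, since [cls] is onto.
   The bound variable becomes a small block of real variables. *)
have tK := small_real_index t.
pose z := cat_sort (@real_sort L K M I E t) (@rsort V s).
pose f : subst z (@rsort _ (ext_sort t s)) := fun v =>
  match v return term z (rsort v) with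
  | existT None j => Var z (inl j)
  | existT (Some v) j => Var z (inr (rvar _ s v j))
  end.
have cl := type_def_sub (f := f) (IHp (small_real_var_ext sK tK)).
apply: type_def_iff (type_def_ex satM tK sK cl) _ => a.
have fE c : heq_tup (sub_tup f (cat_tup c a)) = @ext_tup S H V t s (cls c) (heq_tup a).
  by apply: functional_extensionality_dep => -[].
split=> [[c]|[c Hc]] /=; first by rewrite fE => Hc; exists (cls c).
by have [c' ec] := cls_surj c; exists c'; rewrite fE ec.
Qed.

End Hyperimaginary.

Arguments rvar {L K M I E V} s v j.

(** * Transfer of the tree property *)

(** Compactness: if every pair of consequences were jointly realised by an array, then so would be
    every finite part of the type describing an array for [P] and [Q], and saturation would produce
    one. *)
Lemma type_def_array (L : signature) (K : Type) (M : structure L) k V W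
    (x : V -> sorts L) (y : W -> sorts L) (P : tup M (cat_sort x y) -> Prop)
    (Q : tup M (fun p : 'I_k * W => y p.2) -> Prop) :
  saturated K M -> card_smaller nat K -> card_smaller V K -> card_smaller W K ->
  type_def P -> type_def Q ->
  ~ (exists b : 'I_k -> tup M y, Q (fun p => b p.1 p.2) /\
      exists c : tup M x, forall j, P (cat_tup c (b j))) ->
  exists phi psi, [/\ entails P phi, entails Q psi & ~ sat_array M phi psi].
Proof.
move=> satM nK VK WK clP clQ nPQ; apply: contrapT => H; apply: nPQ.
have {}H phi psi : entails P phi -> entails Q psi -> sat_array M phi psi.
  by move=> *; apply: contrapT => ?; apply: H; exists phi, psi.
pose s0 : void -> sorts L := fun v => match v with end.
have a0 : tup M s0 by case.
pose y' (p : 'I_k * W) := y p.2.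
pose z := cat_sort (cat_sort x y') s0.
pose f : subst z y' := fun p => Var z (inl (inr p)).
pose g j : subst z (cat_sort x y) := fun v =>
  match v return term z (cat_sort x y v) with
  | inl i => Var z (inl (inl i))
  | inr i => Var z (inl (inr (j, i)))
  end.
pose tot (c : tup M x) (b : 'I_k -> tup M y) : tup M z :=
  cat_tup (cat_tup (s' := y') c (fun p => b p.1 p.2)) a0.
have fE c b : sub_tup f (tot c b) = (fun p => b p.1 p.2) by [].
have gE c b j : sub_tup (g j) (tot c b) = cat_tup c (b j).
  by apply: functional_extensionality_dep => -[].
have xK : card_smaller (V + 'I_k * W) K by apply: small_sum => //; exact: small_ord_mul.
have voidK : card_smaller void K.
  by apply: (small_finite (f := fun i : 'I_0 => match notF (ltn_ord i) with end)).
(* The type puts all consequences of [Q] on the rows and all consequences of [P] on each row with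
   the common solution, over an empty tuple of parameters. *)
have [|a aP] := satM _ _ _ _ xK voidK a0 (fun theta =>
    (exists2 psi, entails Q psi & theta = fsub f psi) \/
    (exists phi j, entails P phi /\ theta = fsub (g j) phi)); last first.
  have totE : cat_tup a a0 = tot (fun i => a (inl i)) (fun j i => a (inr (j, i))).
    by apply: functional_extensionality_dep => -[[|[]]|].
  exists (fun j i => a (inr (j, i))); split.
    apply: clQ => psi Hpsi; apply/(sat_fsub psi f (tot (fun i => a (inl i))
      (fun j i => a (inr (j, i))))); rewrite -totE; apply: aP.
    by left; exists psi.
  exists (fun i => a (inl i)) => j; apply: clP => phi Hphi.
  rewrite -(gE (fun i => a (inl i)) (fun j i => a (inr (j, i)))) -sat_fsub -totE.
  by apply: aP; right; exists phi, j.
move=> n theta thetaP.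
(* Each formula of the finite part is charged to [phi] or to [psi], with [Top] on the other side.
   The conjunctions over [i] then yield a single pair. *)
have G i : exists p : form (cat_sort x y) * form y',
    [/\ entails P p.1, entails Q p.2 & forall c (b : 'I_k -> tup M y),
      sat (M := M) (s := y') (fun p => b p.1 p.2) p.2 ->
      (forall j, sat (cat_tup c (b j)) p.1) -> sat (tot c b) (theta i)].
  case: (thetaP i) => [[psi Hpsi ->]|[phi [j [Hphi ->]]]].
    by exists (Top _, psi); split=> // c b Hb _; apply/sat_fsub.
  by exists (phi, Top _); split=> // c b _ Hb; apply/sat_fsub; rewrite gE.
have [p pP] := choice G.
have [||b [Hb [c Hc]]] := H (big_and (fun i => (p i).1)) (big_and (fun i => (p i).2)).
- by move=> b Pb; apply/sat_big_and => i; have [pP1 _ _] := pP i; exact: pP1.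
- by move=> b Qb; apply/sat_big_and => i; have [_ pP1 _] := pP i; exact: pP1.
exists (cat_tup (s' := y') c (fun p => b p.1 p.2)) => i.
have [_ _] := pP i; apply; first by move/sat_big_and: Hb.
by move=> j; move/sat_big_and: (Hc j).
Qed.

(** The real tuples may be infinite, whereas [tree_property] asks for finite ones, so both formulas
    are cut down to the variables they mention. *)
Lemma finite_array (L : signature) k V W (x : V -> sorts L) (y : W -> sorts L)
    (phi : form (cat_sort x y)) (psi : form (fun p : 'I_k * W => y p.2)) :
  exists m n (f : 'I_m -> V) (g : 'I_n -> W)
    (phi' : form (cat_sort (x \o f) (y \o g)))
    (psi' : form (fun p : 'I_k * 'I_n => (y \o g) p.2)),
  [/\ injective f, injective g & forall N : structure L,
    (forall (c : tup N x) (b : tup N y), sat (cat_tup c b) phi <->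
       sat (cat_tup (s := x \o f) (s' := y \o g)
              (fun i => c (f i)) (fun i => b (g i))) phi') /\
    (forall b : 'I_k -> tup N y,
       sat (M := N) (s := fun p : 'I_k * W => y p.2)
         (fun p => b p.1 p.2) psi <->
       sat (M := N) (s := fun p : 'I_k * 'I_n => (y \o g) p.2)
         (fun p => b p.1 (g p.2)) psi')].
Proof.
have [[l1 l1P] [l2 l2P]] := (finite_support phi, finite_support psi).
have [m [f [fI fP]]] := enum_seq
  (pmap (fun v => match v with inl v => Some v | inr _ => None end) l1).
(* The same [g] must serve both formulas, so it enumerates the variables of [y] from the first
   together with those that occur in any row of the second. *)
have [n [g [gI gP]]] := enum_seq
  ((pmap (fun v => match v with inl _ => None | inr w => Some w end) l1
     : seq {classic W}) ++ [seq p.2 | p : 'I_k * W <- l2]).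
pose h (v : 'I_m + 'I_n) := match v with inl i => inl (f i) | inr i => inr (g i) end.
have [|phi' phi'P] := l1P _ h.
  move=> [v|w] vl.
    have [|i <-] := fP v; last by exists (inl i).
    exact: mem_pmap_classic vl _.
  have [|i <-] := gP w; last by exists (inr i).
  by rewrite mem_cat (mem_pmap_classic vl).
have [|psi' psi'P] := l2P _ (fun p : 'I_k * 'I_n => (p.1, g p.2)).
  move=> [j w] vl; have [|i <-] := gP w; last by exists (j, i).
  rewrite mem_cat; apply/orP; right.
  elim: (l2) vl => //= c l IH; rewrite !inE => /predU1P[<-|/IH->]; last exact: orbT.
  by rewrite eqxx.
pose u : subst (cat_sort (x \o f) (y \o g)) (cat_sort x y \o h) := fun v =>
  match v return term (cat_sort (x \o f) (y \o g)) (cat_sort x y (h v)) with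
  | inl i => Var (cat_sort (x \o f) (y \o g)) (inl i)
  | inr i => Var (cat_sort (x \o f) (y \o g)) (inr i)
  end.
exists m, n, f, g, (fsub u phi'), psi'; split=> // N; split=> [c b|b]; last first.
  by rewrite psi'P.
rewrite phi'P sat_fsub.
suff -> : sub_tup u (cat_tup (s := x \o f) (s' := y \o g)
    (fun i => c (f i)) (fun i => b (g i))) = (fun v => cat_tup c b (h v)) by [].
by apply: functional_extensionality_dep => -[].
Qed.

(** By JCP, [M] and [N] map into a common model. The array is pushed forward from [N], and positive
    closedness reflects the sentence asserting its existence back to [M]. *)
Lemma sat_array_pc (L : signature) (T : h_inductive L -> Prop) (M N : structure L)
    k V W (x : V -> sorts L) (y : W -> sorts L) (phi : form (cat_sort x y))
    (psi : form (fun p : 'I_k * W => y p.2)) :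
  JCP T -> pc_model T M -> model T N -> inhabited (tup M x) ->
  inhabited (tup M y) -> 0 < k -> sat_array N phi psi -> sat_array M phi psi.
Proof.
move=> jcp [TM pcM] TN xM yM k0 arrN.
have [N' [TN' [[hM] [hN]]]] := jcp _ _ TM TN.
pose s0 : 'I_0 -> sorts L := fun i => match notF (ltn_ord i) with end.
have [chi chiP] := sat_array_form s0 phi psi.
have e0 : tup M s0 by case.
apply/(chiP _ xM yM e0); apply: (pcM _ hM TN').
apply/chiP; [by case: xM => a; constructor; exact (hom_tup hM a)|
  by case: yM => a; constructor; exact (hom_tup hM a)|].
have hom_sat U (s : U -> sorts L) (theta : form s) (a : tup N s) :
    sat a theta -> sat (hom_tup hN a) theta.
  have hom_eval U' (s' : U' -> sorts L) t (u : term s' t) (d : tup N s') :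
      eval (hom_tup hN d) u = hN _ (eval d u).
    elim: u => //= q args IH; rewrite hom_fun; congr fun_interp.
    exact: functional_extensionality_dep.
  elim: theta a => {U s} [U s|U s|U s t u v|U s r args|U s p IHp q IHq|
                          U s p IHp q IHq|U s t p IHp] a //=.
  - by rewrite !hom_eval => ->.
  - move=> /(hom_rel hN).
    suff -> : (fun i => eval (hom_tup hN a) (args i)) =
              (fun i => hN _ (eval a (args i))) by [].
    by apply: functional_extensionality_dep => i; exact: hom_eval.
  - by move=> [/IHp ? /IHq].
  - by move=> [/IHp|/IHq]; [left|right].
  - move=> [c /IHp Hc]; exists (hN _ c).
    suff <- : hom_tup hN (ext_tup c a) = ext_tup (hN _ c) (hom_tup hN a) by [].
    by apply: functional_extensionality_dep => -[].
case: arrN => b [Hb [c Hc]]; exists (fun j => hom_tup hN (b j)); split.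
  exact: hom_sat Hb.
exists (hom_tup hN c) => j.
suff <- : hom_tup hN (cat_tup c (b j)) = cat_tup (hom_tup hN c) (hom_tup hN (b j)).
  exact: hom_sat.
by apply: functional_extensionality_dep => -[].
Qed.

Lemma heq_tree_property (L : signature) (T : h_inductive L -> Prop) (K : Type)
    (M : structure L) (I : Type) (E : I -> type_def_equiv K M) :
  JCP T -> pc_model T M -> saturated K M -> card_smaller nat K ->
  tree_property (heq_theory E) (heq_structure E) -> tree_property T M.
Proof.
move=> jcp pcM satM nK.
move=> [m [n [x [y [phi [k [psi [a [k2 [incon [con psiP]]]]]]]]]]].
pose H := heq_structure E.
(* [r] lifts the tree to representatives, node by node. *)
have [r rP] := choice (fun eta => heq_tup_surj (a eta)).
pose xr := @rsort L K M I E _ x; pose yr := @rsort L K M I E _ y.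
pose f : subst (cat_sort xr yr) (@rsort L K M I E _ (cat_sort x y)) := fun v =>
  match v return term (cat_sort xr yr) (rsort v) with
  | existT (inl i) j => Var (cat_sort xr yr) (inl (rvar x i j))
  | existT (inr i) j => Var (cat_sort xr yr) (inr (rvar y i j))
  end.
pose yk (p : 'I_k * 'I_n) := y p.2.
pose ykr (p : 'I_k * real_var y) := yr p.2.
pose g : subst ykr (@rsort L K M I E _ yk) := fun v =>
  match v return term ykr (rsort v) with
  | existT p j => Var ykr (p.1, rvar y p.2 j)
  end.
have fE c b : heq_tup (sub_tup f (cat_tup c b)) = cat_tup (heq_tup c) (heq_tup b).
  by apply: functional_extensionality_dep => -[].
have gE (b : 'I_k -> tup M yr) :
    heq_tup (sub_tup (s := ykr) g (fun p => b p.1 p.2)) =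
    (fun p : 'I_k * 'I_n => heq_tup (b p.1) p.2).
  by apply: functional_extensionality_dep => -[].
have clP := type_def_sub (f := f) (type_def_heq_sat satM nK (phi := phi)
  (small_real_var nK _)).
have clQ := type_def_sub (f := g) (type_def_heq_sat satM nK (phi := psi)
  (small_real_var nK _)).
have [|phi0 [psi0 [Pphi Qpsi narr]]] := type_def_array satM nK
    (small_real_var nK x) (small_real_var nK y) clP clQ.
  (* The classes of such an array would contradict the inconsistency in the expansion, which is
     itself a model of $T^{\mathcal E}$. *)
  move=> [b [Hb [c Hc]]]; apply: (incon H) => //.
  exists (fun j => heq_tup (b j)); rewrite gE in Hb; split=> //.
  by exists (heq_tup c) => j; rewrite -fE.
have [c0 _] := con id; have [cr _] := heq_tup_surj c0.
have [m' [n' [f' [g' [phi' [psi' [fI gI arrP]]]]]]] := finite_array phi0 psi0.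
(* The new tree keeps, at each node, the finitely many coordinates of the representatives selected
   by [g']. *)
exists m', n', (xr \o f'), (yr \o g'), phi', k, psi', (fun eta i => r eta (g' i)).
split=> //; split; last first.
  split=> [sigma|eta i ltI].
    have [c cP] := con sigma; have [d dP] := heq_tup_surj c.
    exists (fun i => d (f' i)) => l; apply/(arrP M).1/Pphi.
    by rewrite fE dP rP.
  apply/((arrP M).2 (fun j => r (rcons eta (i j))))/Qpsi.
  rewrite (gE (fun j => r (rcons eta (i j)))); move: (psiP eta i ltI).
  suff -> : (fun p : 'I_k * 'I_n => a (rcons eta (i p.1)) p.2) =
    (fun p => heq_tup (r (rcons eta (i p.1))) p.2) by [].
  by apply: functional_extensionality_dep => p; rewrite rP.
move=> N TN arrN; apply: narr.
have [b' [Hb [c' Hc]]] : sat_array M phi' psi'.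
  apply: sat_array_pc jcp pcM TN _ _ (ltnW k2) arrN; constructor.
    by move=> i; exact: cr.
  by move=> i; exact: r [::] _.
(* The finite tuples found in [M] are completed to full real tuples, with default values from [cr]
   and from the root of the lifted tree. *)
have [c cE] := extend_tup cr c' fI.
have [b bE] := dep_choice (fun j => extend_tup (r [::]) (b' j) gI).
exists b; split.
  apply/(arrP M).2; move: Hb.
  suff -> : (fun p : 'I_k * 'I_n' => b' p.1 p.2) = (fun p => b p.1 (g' p.2)) by [].
  by apply: functional_extensionality_dep => -[j i] /=; rewrite -bE.
by exists c => j; apply/(arrP M).1; rewrite cE bE.
Qed.

Theorem theorem7p19 (L : signature) (T : h_inductive L -> Prop) (K : Type)
    (M : structure L) (I : Type) (E : I -> type_def_equiv K M) :
  theory T -> JCP T -> monster T K M ->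
  (simple T M <-> simple (heq_theory E) (heq_structure E)).
Proof.
move=> _ jcp [cardK [pcM [satM _]]]; split=> simp tp; apply: simp.
  apply: heq_tree_property tp => //; apply: injects_small cardK.
  by exists inr => ? ? [].
by apply: tree_property_heq tp; case: pcM.
Qed.
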